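(* Let $\mathscr{R}$ be a ring of subsets of a nonempty set $T$, and let $\alpha,\beta$ be real or complex valued (finitely) additive set functions on $\mathscr{R}$ such that $\alpha$ is nonnegative and $\beta$ is bounded. If $\beta$ is absolutely continuous with respect to $\alpha$, then there is a sequence $(\varphi_n)_{n\in\mathbb{N}}$ of $\mathscr{R}$-simple functions such that $$\beta(E)=\lim_{n\to\infty}\int_E\varphi_n\,d\alpha\qquad\text{for all } E\in\mathscr{R}.$$ If $\alpha$ is bounded too, then, letting $\beta_n(E):=\int_E\varphi_n\,d\alpha$ for $E\in\mathscr{R}$, we have at the same time $$\sup_{E\in\mathscr{R}}|\beta-\beta_n|(E)\to0.$$
   Context: An additive set function $\beta$ on $\mathscr{R}$ is bounded if $\sup_{E\in\mathscr{R}}|\beta(E)|<\infty$. For a bounded additive set function $\gamma$, $|\gamma|$ denotes its total variation: $|\gamma|(E)$ is the supremum of $\sum_i|\gamma(E_i)|$ over all finite partitions of $E$ into pairwise disjoint sets $E_i\in\mathscr{R}$. The set function $\alpha$ is finite-valued but not assumed bounded in the first assertion. $\mathscr{R}$-simple functions are finite (real or complex, respectively) linear combinations of characteristic functions of sets in $\mathscr{R}$, integrated against additive set functions in the usual elementary way. $\beta$ is absolutely continuous with respect to $\alpha$ if for any $\varepsilon>0$ there exists $\delta>0$ such that for all $E\in\mathscr{R}$, $\alpha(E)<\delta$ implies $|\beta|(E)<\varepsilon$. *)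

(* Defs.v *)
From HB Require Import structures.
From mathcomp Require Import all_boot all_order all_algebra.
From mathcomp Require Import all_classical all_reals all_analysis.
From mathcomp Require Import complex.

Set Implicit Arguments.
Unset Strict Implicit.
Unset Printing Implicit Defensive.

Import Order.TTheory GRing.Theory Num.Theory.
Import numFieldNormedType.Exports.

Local Open Scope classical_set_scope.
Local Open Scope ring_scope.

(* [Rcomplex R] is [R[i]] seen as a real vector space, with the modulus as an
   [R]-valued norm.  The instances below add the topology of that norm, so that
   the real field [R] and the complex field [Rcomplex R] are both normed
   [R]-modules and share the definitions that follow. *)
Section Rcomplex_normedModType.
Variable R : realType.

Lemma Rcomplex_normrZ (l : R) (x : Rcomplex R) : `|l *: x| = `|l| * `|x|.
Proof.
case: x => a b; rewrite /Num.norm /= !exprMn -mulrDr.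
by rewrite sqrtrM ?sqr_ge0// sqrtr_sqr.
Qed.

HB.instance Definition _ :=
  PseudoMetric.copy (Rcomplex R) (pseudoMetric_normed (Rcomplex R)).
HB.instance Definition _ := isPointed.Build (Rcomplex R) 0.
HB.instance Definition _ :=
  NormedZmod_PseudoMetric_eq.Build R (Rcomplex R) erefl.
HB.instance Definition _ :=
  PseudoMetricNormedZmod_Lmodule_isNormedModule.Build R (Rcomplex R)
    Rcomplex_normrZ.

End Rcomplex_normedModType.

(* The ring of sets is the family of [measurable] sets of a [ringOfSetsType]
   (a pointed type, hence nonempty).  A set function on it is a function on
   [set T] whose values outside the ring play no role. *)
Section set_functions.
Context d (T : ringOfSetsType d) (R : realType) (V : normedModType R).
Implicit Types (alpha : set T -> R) (beta : set T -> V) (phi : T -> V).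

Definition set_additive beta := forall A B : set T,
  measurable A -> measurable B -> A `&` B = set0 ->
  beta (A `|` B) = beta A + beta B.

Definition set_bounded beta :=
  (ereal_sup [set `|beta E|%:E | E in measurable] < +oo)%E.

Definition finite_partition (E : set T) n (F : 'I_n -> set T) :=
  [/\ forall i, measurable (F i), trivIset setT F & \bigcup_i F i = E].

Definition set_variation beta (E : set T) : \bar R :=
  ereal_sup [set x | exists n (F : 'I_n -> set T),
    finite_partition E F /\ x = (\sum_(i < n) `|beta (F i)|)%:E].

Definition set_abs_continuous beta alpha :=
  forall e : R, 0 < e -> exists2 delta : R, 0 < delta &
    forall E, measurable E -> alpha E < delta ->
      (set_variation beta E < e%:E)%E.

Definition ring_simple phi := exists n (c : 'I_n -> V) (A : 'I_n -> set T),
  (forall i, measurable (A i)) /\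
  phi = (fun x => \sum_(i < n) (\1_(A i) x : R) *: c i).

(* For [phi] simple, the preimage of a nonzero value belongs to the ring and
   [phi] takes finitely many values; the value [0] contributes nothing. *)
Definition simple_integral alpha (E : set T) phi : V :=
  \sum_(v \in range phi) alpha (E `&` phi @^-1` [set v]) *: v.

End set_functions.

(* Main.v *)
(* Since beta is bounded, it is uniformly small off some set E of the ring, so
   everything happens on E, where alpha is finite.  There, consider the total
   variation of the R^2-valued set function (alpha, beta) for the Euclidean
   norm, that is the supremum of the sums of sqrt(alpha(A)^2 + beta(A)^2) over
   the partitions of E, and let phi be beta(A)/alpha(A) on the cells A of a
   nearly maximal partition.  Strict convexity of the Euclidean ball makes
   beta - int phi dalpha uniformly small: cutting the cells by a set F increases
   the sum very little, hence the vectors (alpha, beta)(A `&` F) are nearly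
   parallel to (alpha, beta)(A).  Cells where |beta|/alpha is large have small
   total alpha-measure and are dealt with by absolute continuity.  The complex
   case follows from the real and imaginary parts. *)
Require Import Defs.
From mathcomp Require Import all_boot all_order all_algebra.
From mathcomp Require Import all_classical all_reals all_analysis.
From mathcomp Require Import complex ring lra.

Set Implicit Arguments.
Unset Strict Implicit.
Unset Printing Implicit Defensive.

Import Order.TTheory GRing.Theory Num.Theory.
Import numFieldNormedType.Exports.

Local Open Scope classical_set_scope.
Local Open Scope ring_scope.

(** * Finitely additive set functions on a ring of sets *)

Section additive_set_functions.
Context d (T : ringOfSetsType d) (R : realType) (V : normedModType R).
Implicit Types (beta : set T -> V) (E F : set T).

Lemma measurable_bigcup_fin (I : finType) (P : pred I) (F : I -> set T) :
  (forall i, measurable (F i)) -> measurable (\bigcup_(i in [set` P]) F i).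
Proof.
move=> mF.
have -> : [set` P] = [set i | (i \in index_enum I) && P i].
  by apply/seteqP; split => i /=; rewrite mem_index_enum.
by rewrite bigcup_seq_cond; apply: bigsetU_measurable.
Qed.

Lemma additive_set0 beta : set_additive beta -> beta set0 = 0.
Proof.
move=> /(_ set0 set0 measurable0 measurable0 (setI0 _)).
by rewrite setU0 => /esym/eqP; rewrite -subr_eq0 addrK => /eqP.
Qed.

Lemma additive_bigcup beta (I : finType) (P : pred I) (F : I -> set T) :
  set_additive beta -> (forall i, measurable (F i)) -> trivIset setT F ->
  beta (\bigcup_(i in [set` P]) F i) = \sum_(i | P i) beta (F i).
Proof.
move=> beta_add mF tF.
have -> : [set` P] = [set i | (i \in index_enum I) && P i].
  by apply/seteqP; split => i /=; rewrite mem_index_enum.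
rewrite bigcup_seq_cond.
have := index_enum_uniq I; elim: (index_enum I) => [_|i r IHr /= /andP[ir ur]].
  by rewrite !big_nil additive_set0.
rewrite !big_cons; case: ifPn => _; last exact: IHr.
rewrite beta_add ?IHr//; first exact: bigsetU_measurable.
rewrite -bigcup_seq_cond setI_bigcupr; apply: bigcup0 => j /= /andP[jr _].
by move/trivIsetP: tF; apply => //; apply: contraNneq ir => ->.
Qed.

(** Everything is cut down to [E] because a whole fiber of [s] need not lie in the ring. *)
Lemma additive_fibers beta (S : finType) (s : T -> S) (P : pred S) E :
  set_additive beta -> (forall j, measurable (E `&` s @^-1` [set j])) ->
  beta (E `&` s @^-1` [set` P]) = \sum_(j | P j) beta (E `&` s @^-1` [set j]).
Proof.
move=> beta_add mE; rewrite -additive_bigcup//; first congr (beta _).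
- apply/seteqP; split => [x [Ex Px]|x [j Pj [Ex /= sx]]]; first by exists (s x).
  by split => //; rewrite /preimage /= sx.
- by move=> i j _ _ [x [[_ <-] [_ <-]]].
Qed.

Lemma additive_setIDC beta E F : set_additive beta ->
  measurable E -> measurable F -> beta E = beta (E `&` F) + beta (E `\` F).
Proof.
move=> beta_add mE mF; rewrite -beta_add ?setUIDK//.
- exact: measurableI.
- exact: measurableD.
- by rewrite setDE setIACA setICr setI0.
Qed.

Lemma finite_partition_sum beta n (A : 'I_n -> set T) E F : set_additive beta ->
  finite_partition E A -> measurable F -> F `<=` E ->
  beta F = \sum_(i < n) beta (F `&` A i).
Proof.
move=> beta_add [mA tA UA] mF FE.
rewrite -additive_bigcup//.
- congr beta; rewrite -setI_bigcupr; apply/esym/setIidl => x /FE.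
  by rewrite -UA => -[i _ Aix]; exists i.
- by move=> i; exact: measurableI.
- by apply: trivIset_setIl.
Qed.

End additive_set_functions.

(** * Integrals of simple functions and approximation in variation *)

Section simple_integrals.
Context d (T : ringOfSetsType d) (R : realType) (V : normedModType R).
Implicit Types (alpha : set T -> R) (beta : set T -> V) (E F : set T).

(* The sets [A i] may overlap; everything is computed on their atoms, which are
   the fibers of the map sending [x] to the set of indices [i] with
   [x \in A i]. *)
Lemma simple_integralE alpha n (c : 'I_n -> V) (A : 'I_n -> set T) E :
  set_additive alpha -> (forall i, measurable (A i)) -> measurable E ->
  simple_integral alpha E (fun x => \sum_(i < n) (\1_(A i) x : R) *: c i) =
  \sum_(i < n) alpha (E `&` A i) *: c i.
Proof.
move=> alpha_add mA mE.
pose s (x : T) : {set 'I_n} := [set i | x \in A i]%SET.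
pose g (J : {set 'I_n}) := \sum_(i in J) c i.
pose a J := alpha (E `&` s @^-1` [set J]).
have sgE x : \sum_(i < n) (\1_(A i) x : R) *: c i = g (s x).
  rewrite /g [RHS]big_mkcond /=; apply: eq_bigr => i _.
  by rewrite inE indicE; case: (x \in A i); rewrite ?scale1r ?scale0r.
have mEs J : measurable (E `&` s @^-1` [set J]).
  (* A ring is not closed under complements, so the atom is obtained from [E] by removing the points
     whose membership in some [A i] disagrees with [J]. *)
  pose B i := if i \in J then E `\` A i else E `&` A i.
  have -> : E `&` s @^-1` [set J] = E `\` \bigcup_(i in [set` 'I_n]) B i.
    apply/seteqP; split => x [Ex /= sx]; split => //.
      move=> [i _]; rewrite /B -sx inE; case: (boolP (x \in A i)).
        by rewrite inE => Aix [_ /(_ Aix)].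
      by move=> /negP Aix [_ ?]; apply: Aix; rewrite inE.
    apply/setP => i; rewrite inE; apply/idP/idP => [Aix|iJ].
      apply: contra_notT sx => iJ; exists i => //.
      by rewrite /B (negPf iJ); split => //; exact: set_mem.
    apply: contra_notT sx => Aix; exists i => //.
    by rewrite /B iJ; split => // /mem_set; exact/negP.
  apply: measurableD => //; apply: measurable_bigcup_fin => i; rewrite /B.
  by case: ifP => _; [exact: measurableD|exact: measurableI].
have -> : \sum_(i < n) alpha (E `&` A i) *: c i = \sum_J a J *: g J.
  (* The part of [E] in [A i] is the disjoint union of the atoms [J] containing [i]; exchanging the
     sums then collects [g J] on each atom. *)
  transitivity (\sum_(i < n) \sum_(J : {set 'I_n} | i \in J) a J *: c i).
    apply: eq_bigr => i _; rewrite -scaler_suml; congr (_ *: _).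
    rewrite -(additive_fibers (fun J : {set 'I_n} => i \in J) alpha_add mEs).
    by congr alpha; congr setI; apply/seteqP; split => x /=;
       rewrite /preimage /= unfold_in /= inE => /[1!inE].
  rewrite (exchange_big_dep predT)//=; apply: eq_bigr => J _.
  by rewrite scaler_sumr.
(* [r] lists all candidate values. One that is not attained has an empty preimage, and its
   coefficient is [alpha set0 = 0]. *)
pose r := undup [seq g J | J : {set 'I_n}].
rewrite /simple_integral (@fsbig_fwiden _ _ _ _ r); first last.
- move=> v [_ /= Nv].
  rewrite [X in alpha (_ `&` X)](_ : _ = set0).
    by rewrite setI0 (additive_set0 alpha_add) scale0r.
  by apply/seteqP; split => // x /= xv; apply: Nv; exists x.
- exact: undup_uniq.
- move=> _ [x _ <-] /=; rewrite sgE mem_undup.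
  by apply/mapP; exists (s x); rewrite ?mem_enum.
(* Several atoms may carry the same value: the fiber over [v] is the union of the atoms with
   [g J = v]. *)
transitivity (\sum_(v <- r) \sum_(J | g J == v) a J *: g J).
  apply: eq_bigr => v _.
  under [RHS]eq_bigr => J /eqP -> do over.
  rewrite -scaler_suml -(additive_fibers (fun J => g J == v) alpha_add mEs).
  congr (alpha (E `&` _) *: v); apply/seteqP.
  by split => x; rewrite /preimage /= sgE unfold_in => /eqP.
rewrite (exchange_big_dep predT)//=; apply: eq_bigr => J _.
have gJr : g J \in r by rewrite mem_undup; apply/mapP; exists J; rewrite ?mem_enum.
rewrite big_mkcond (bigD1_seq (g J)) ?undup_uniq//= eqxx big1 ?addr0// => v.
by rewrite eq_sym => /negPf ->.
Qed.

Lemma ring_simpleD (phi psi : T -> V) :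
  ring_simple phi -> ring_simple psi -> ring_simple (fun x => phi x + psi x).
Proof.
move=> [n [c [A [mA ->]]]] [m [b [B [mB ->]]]].
exists (n + m)%N,
  (fun k => match fintype.split k with inl i => c i | inr j => b j end),
  (fun k => match fintype.split k with inl i => A i | inr j => B j end).
split; first by move=> k; case: fintype.split.
apply/funext => x; rewrite big_split_ord /=; congr (_ + _).
- by apply: eq_bigr => i _; rewrite (unsplitK (inl i)).
- by apply: eq_bigr => i _; rewrite (unsplitK (inr i)).
Qed.

(** Concatenating the two families of sets represents the sum; [simple_integralE] allows overlaps,
    which spares a common refinement. *)
Lemma simple_integralD alpha (phi psi : T -> V) E : set_additive alpha ->
  ring_simple phi -> ring_simple psi -> measurable E ->
  simple_integral alpha E (fun x => phi x + psi x) =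
  simple_integral alpha E phi + simple_integral alpha E psi.
Proof.
move=> alpha_add [n [c [A [mA ->]]]] [m [b [B [mB ->]]]] mE.
rewrite (simple_integralE c alpha_add mA mE) (simple_integralE b alpha_add mB mE).
pose cb (k : 'I_(n + m)) :=
  match fintype.split k with inl i => c i | inr j => b j end.
pose AB (k : 'I_(n + m)) :=
  match fintype.split k with inl i => A i | inr j => B j end.
have mAB k : measurable (AB k) by rewrite /AB; case: fintype.split.
transitivity (simple_integral alpha E
    (fun x => \sum_(k < n + m) (\1_(AB k) x : R) *: cb k)).
  congr simple_integral; apply/funext => x.
  rewrite big_split_ord /=; congr (_ + _); apply: eq_bigr => i _.
  - by rewrite /AB /cb (unsplitK (inl i)).
  - by rewrite /AB /cb (unsplitK (inr i)).
rewrite simple_integralE// big_split_ord /=.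
by congr (_ + _); apply: eq_bigr => i _; rewrite /AB /cb;
   [rewrite (unsplitK (inl i))|rewrite (unsplitK (inr i))].
Qed.

(** The bound over all finite disjoint families controls the variation of the difference on every
    set at once; a family with one member gives the pointwise error. *)
Definition approximable alpha beta := forall e : R, 0 < e ->
  exists phi : T -> V, ring_simple phi /\
    forall n (F : 'I_n -> set T), (forall i, measurable (F i)) ->
      trivIset setT F ->
      \sum_(i < n) `|beta (F i) - simple_integral alpha (F i) phi| <= e.

Lemma approximableD alpha (beta gamma : set T -> V) : set_additive alpha ->
  approximable alpha beta -> approximable alpha gamma ->
  approximable alpha (fun E => beta E + gamma E).
Proof.
move=> alpha_add happ gapp e e0.
have e20 : 0 < e / 2 by rewrite divr_gt0.
have [phi [sphi hphi]] := happ _ e20; have [psi [spsi hpsi]] := gapp _ e20.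
exists (fun x => phi x + psi x); split; first exact: ring_simpleD.
move=> n F mF tF; rewrite (splitr e).
apply: le_trans (lerD (hphi _ _ mF tF) (hpsi _ _ mF tF)).
rewrite -big_split /=; apply: ler_sum => i _.
by rewrite simple_integralD// opprD addrACA ler_normD.
Qed.

(** The [n]-th function is chosen for the tolerance [1 / (n + 1)], which bounds both the pointwise
    error and the supremum of the variations. *)
Lemma approximable_cvg alpha beta : approximable alpha beta ->
  exists phi : nat -> T -> V,
  let beta_ n E := simple_integral alpha E (phi n) in
  [/\ forall n, ring_simple (phi n),
      forall E, measurable E -> beta_ n E @[n --> \oo] --> beta E
    & ereal_sup [set set_variation (fun F => beta F - beta_ n F) E
                | E in measurable] @[n --> \oo] --> 0%E].
Proof.
move=> happ; have /choice[phi hphi] n := happ n.+1%:R^-1 ltac:(by rewrite invr_gt0).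
exists phi => beta_; split => [n|E mE|]; first by case: (hphi n).
- apply/cvgrPdist_le => e e0; near=> n.
  have [_ /(_ 1%N (fun=> E))] := hphi n.
  rewrite big_ord1 => /(_ (fun=> mE) _)/le_trans; apply; last first.
    by apply: ltW; near: n; exact: near_infty_natSinv_lt (PosNum e0).
  by move=> i j _ _ _; rewrite !ord1.
- apply: (@squeeze_cvge _ _ _ _ (cst 0%E) _ (fun n => (n.+1%:R^-1)%:E)).
  + near=> n; apply/andP; split.
      apply: le_trans (ereal_sup_ubound _); last by exists set0.
      (* The partition of [set0] into no cells contributes the empty sum, so the supremum is at
         least [0]. *)
      apply: ereal_sup_ubound; exists 0%N, (fun=> set0).
      rewrite big_ord0; split => //; split => //; first by move=> [].
      by apply/seteqP; split => // x [[]].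
    apply: ge_ereal_sup => _ [E mE <-]; apply: ge_ereal_sup.
    move=> _ [k [F [[mF tF _] ->]]]; rewrite lee_fin.
    by have [_] := hphi n; apply.
  + exact: cvg_cst.
  + exact: cvge_harmonic.
Unshelve. all: by end_near.
Qed.

End simple_integrals.

(** * Multiplying real set functions by a fixed vector *)

Lemma simple_integralZr d (T : ringOfSetsType d) (R : realType)
    (V : normedModType R) (alpha : set T -> R) (phi : T -> R) (v : V) E :
  set_additive alpha -> ring_simple phi -> measurable E ->
  simple_integral alpha E (fun x => phi x *: v) = simple_integral alpha E phi *: v.
Proof.
move=> alpha_add [n [c [A [mA ->]]]] mE.
rewrite simple_integralE// scaler_suml.
transitivity (simple_integral alpha E
    (fun x => \sum_(i < n) (\1_(A i) x : R) *: (c i *: v))).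
  congr simple_integral; apply/funext => x; rewrite scaler_suml.
  by apply: eq_bigr => i _; rewrite scalerA.
by rewrite simple_integralE//; apply: eq_bigr => i _; rewrite scalerA.
Qed.

Lemma ring_simpleZr d (T : ringOfSetsType d) (R : realType)
    (V : normedModType R) (phi : T -> R) (v : V) :
  ring_simple phi -> ring_simple (fun x => phi x *: v).
Proof.
move=> [n [c [A [mA ->]]]]; exists n, (fun i => c i *: v), A; split => //.
apply/funext => x; rewrite scaler_suml.
by apply: eq_bigr => i _; rewrite scalerA.
Qed.

Lemma approximableZr d (T : ringOfSetsType d) (R : realType)
    (V : normedModType R) (alpha : set T -> R) (beta : set T -> R) (v : V) :
  set_additive alpha -> approximable alpha beta ->
  approximable alpha (fun E => beta E *: v).
Proof.
move=> alpha_add happ e e0.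
(* The summand [1] keeps the divisor positive when [v = 0]. *)
have v0 : 0 < `|v| + 1 by rewrite ltr_wpDl.
have [phi [sphi hphi]] := happ _ (divr_gt0 e0 v0).
exists (fun x => phi x *: v); split; first exact: ring_simpleZr.
move=> n F mF tF; under eq_bigr => i _.
  rewrite simple_integralZr// -scalerBl normrZ; over.
rewrite -mulr_suml.
apply: (le_trans (ler_wpM2r (normr_ge0 v) (hphi _ _ mF tF))).
by rewrite -mulrA ger_pMr// mulrC ler_pdivrMr// mul1r lerDl.
Qed.

(** * The Euclidean norm of the plane and the defect of its triangle inequality *)

Section hypot.
Context {R : rcfType}.
Implicit Types a b x y s K : R.

Definition hypot a b : R := Num.sqrt (a ^+ 2 + b ^+ 2).

Lemma hypot_ge0 a b : 0 <= hypot a b.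
Proof. exact: sqrtr_ge0. Qed.

Lemma sqr_hypot a b : hypot a b ^+ 2 = a ^+ 2 + b ^+ 2.
Proof. by rewrite sqr_sqrtr ?addr_ge0 ?sqr_ge0. Qed.

Lemma normr_le_hypot a b : `|a| <= hypot a b.
Proof. by rewrite -sqrtr_sqr ler_wsqrtr// lerDl sqr_ge0. Qed.

Lemma hypot_le_add a b : hypot a b <= `|a| + `|b|.
Proof.
rewrite -ler_sqr ?nnegrE ?addr_ge0 ?hypot_ge0// sqr_hypot sqrrD.
by rewrite !real_normK ?num_real// lerD2r lerDl mulrn_wge0// mulr_ge0.
Qed.

Lemma cauchy_schwarz_hypot a b x y : a * x + b * y <= hypot a b * hypot x y.
Proof.
apply: le_trans (ler_norm _) _.
rewrite -ler_sqr ?nnegrE ?mulr_ge0 ?hypot_ge0// exprMn !sqr_hypot.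
rewrite real_normK ?num_real//.
(* Lagrange's identity: this square is the difference of the two sides. *)
have := sqr_ge0 (a * y - b * x); nra.
Qed.

Lemma hypotD a b x y : hypot (a + x) (b + y) <= hypot a b + hypot x y.
Proof.
rewrite -ler_sqr ?nnegrE ?addr_ge0 ?hypot_ge0// sqrrD !sqr_hypot.
have := cauchy_schwarz_hypot a b x y; rewrite -mulr_natr; nra.
Qed.

(* Write [N := hypot a b] and let [q] be the component of [(a, b)] along the sum
   [(a + x, b + y)].  The component [p] orthogonal to that sum satisfies
   [p ^+ 2 = (N - q) * (N + q) <= 2 * N * (N - q)], so AM-GM gives
   [p <= s * N + (N - q) / (2 * s)]; finally the defect of the triangle
   inequality bounds [N - q]. *)
Lemma hypot_defect_bound a b x y K s : 0 < s -> 0 < a + x ->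
  `|b + y| <= K * (a + x) ->
  `|b - (b + y) / (a + x) * a| <= (1 + K) *
    (s * hypot a b + (hypot a b + hypot x y - hypot (a + x) (b + y)) / (2 * s)).
Proof.
move=> s0 ax0 bK.
set f := (b + y) / (a + x).
have fE : b + y = f * (a + x) by rewrite divfK ?gt_eqF.
have fK : `|f| <= K by rewrite normrM normfV (gtr0_norm ax0) ler_pdivrMr.
(* [(1, f) / w] is the unit vector along the sum; [q] and [p] below are the component of [(a, b)]
   along it and the length of the orthogonal one. *)
pose w := hypot 1 f.
have w1 : 1 <= w by apply: le_trans (normr_le_hypot 1 f); rewrite normr1.
have wK : w <= 1 + K by rewrite (le_trans (hypot_le_add _ _))// normr1 lerD2l.
have w0 : 0 < w by exact: lt_le_trans w1.
have NE : hypot (a + x) (b + y) = (a + x) * w.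
  rewrite /hypot fE exprMn -[X in X + _]mul1r -mulrDl sqrtrM.
    by rewrite sqrtr_sqr (gtr0_norm ax0) mulrC /w /hypot expr1n.
  by rewrite addr_ge0 ?sqr_ge0.
have w2 : w ^+ 2 = 1 + f ^+ 2 by rewrite sqr_hypot expr1n.
set N := hypot a b; set N' := hypot x y.
have N0 : 0 <= N := hypot_ge0 a b.
pose q := (a + f * b) / w; pose p := `|b - f * a| / w.
have qN : q <= N.
  rewrite ler_pdivrMr//; have := cauchy_schwarz_hypot a b 1 f.
  by rewrite mulr1 [b * f]mulrC.
have q'N : (x + f * y) / w <= N'.
  rewrite ler_pdivrMr//; have := cauchy_schwarz_hypot x y 1 f.
  by rewrite mulr1 [y * f]mulrC.
(* The components of both vectors along the sum add up to its length. As that of [(x, y)] is at most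
   [N'], [N - q] is at most the defect. *)
have qq' : q + (x + f * y) / w = (a + x) * w.
  rewrite -mulrDl; apply: (mulIf (lt0r_neq0 w0)).
  rewrite divfK ?gt_eqF// -[RHS]mulrA -expr2 w2.
  rewrite [f * y](_ : _ = f * (f * (a + x) - b)).
    by ring.
  by rewrite -fE addrC addKr.
have p0 : 0 <= p by rewrite divr_ge0// ltW.
have pq : p ^+ 2 + q ^+ 2 = N ^+ 2.
  rewrite !expr_div_n -mulrDl real_normK ?num_real// [N ^+ 2]sqr_hypot.
  have w20 : w ^+ 2 != 0 by rewrite expf_neq0// gt_eqF.
  by apply: (mulIf w20); rewrite divfK// w2; ring.
pose t := s * N + (N - q) / (2 * s).
have s20 : 0 < 2 * s by rewrite mulr_gt0.
have t0 : 0 <= t.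
  by rewrite addr_ge0 ?(divr_ge0 _ (ltW s20)) ?(mulr_ge0 (ltW s0)) ?subr_ge0.
have pt : p <= t.
  rewrite -ler_sqr ?nnegrE//.
  have e : (N - q) / (2 * s) * (2 * s) = N - q by rewrite divfK ?gt_eqF.
  have u0 : 0 <= (N - q) / (2 * s) by rewrite divr_ge0 ?subr_ge0// ltW.
  rewrite /t; move: ((N - q) / (2 * s)) e u0 => u e u0.
  have := sqr_ge0 (s * N - u); nra.
have -> : `|b - f * a| = w * p by rewrite [w * p]mulrC /p divfK ?gt_eqF.
apply: (le_trans (ler_wpM2l (ltW w0) pt)).
apply: (ler_pM (ltW w0) t0 wK); rewrite /t.
rewrite lerD2l ler_wpM2r// ?invr_ge0 ?(ltW s20)// NE -qq'; lra.
Qed.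

End hypot.

(** * Bounded additive set functions *)

Section bounded_set_functions.
Context d (T : ringOfSetsType d) (R : realType).
Implicit Types (E F : set T).

Lemma set_boundedP (V : normedModType R) (beta : set T -> V) :
  set_bounded beta -> exists M, forall E, measurable E -> `|beta E| <= M.
Proof.
move=> bb; exists (fine (ereal_sup [set `|beta E|%:E | E in measurable])).
move=> E mE.
have le_sup : (`|beta E|%:E <= ereal_sup [set `|beta F|%:E | F in measurable])%E.
  by apply: ereal_sup_ubound; exists E.
rewrite -lee_fin fineK//; apply/fin_real/andP; split => //.
exact: lt_le_trans (ltNyr _) le_sup.
Qed.

Lemma le_set_variation (V : normedModType R) (beta : set T -> V) E :
  measurable E -> (`|beta E|%:E <= set_variation beta E)%E.
Proof.
move=> mE; apply: ereal_sup_ubound; exists 1%N, (fun=> E).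
rewrite big_ord1; split => //; split => //; first by move=> i j _ _ _; rewrite !ord1.
by apply/seteqP; split => [x []//|x Ex]; exists ord0.
Qed.

(** Group the cells by the sign of [gamma]: within each group the absolute values add up to
    [|gamma|] of the union, which is at most [M]. *)
Lemma sum_norm_le (gamma : set T -> R) M n (F : 'I_n -> set T) :
  set_additive gamma -> (forall E, measurable E -> `|gamma E| <= M) ->
  (forall i, measurable (F i)) -> trivIset setT F ->
  \sum_(i < n) `|gamma (F i)| <= 2 * M.
Proof.
move=> gamma_add gammaM mF tF; pose P i := 0 <= gamma (F i).
rewrite (bigID P) /= mulr_natl mulr2n; apply: lerD.
  under eq_bigr do rewrite ger0_norm//.
  rewrite -additive_bigcup//; apply: le_trans (ler_norm _) (gammaM _ _).
  exact: measurable_bigcup_fin.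
under eq_bigr => i Pi do rewrite ltr0_norm ?ltNge//.
rewrite sumrN -additive_bigcup//; apply: le_trans (ler_norm _) _.
by rewrite normrN; apply: gammaM; exact: measurable_bigcup_fin.
Qed.

(** Take [E] with [beta E] within [e] of the supremum of [beta]: a disjoint [F] with [beta F > e]
    would push the union above that supremum. *)
Lemma small_off_measurable_pos (beta : set T -> R) M e :
  set_additive beta -> (forall E, measurable E -> `|beta E| <= M) -> 0 < e ->
  exists2 E, measurable E &
    forall F, measurable F -> F `&` E = set0 -> beta F <= e.
Proof.
move=> beta_add betaM e0; pose S := [set beta E | E in measurable].
have supS : has_sup S.
  split; first by exists (beta set0), set0.
  by exists M => _ [E mE <-]; exact: le_trans (ler_norm _) (betaM _ mE).
have [_ [E mE <-] supE] := sup_adherent e0 supS.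
exists E => // F mF FE; rewrite leNgt; apply/negP => eF.
have : beta (F `|` E) <= sup S.
  by apply: ub_le_sup; [case: supS|exists (F `|` E) => //; exact: measurableU].
rewrite beta_add// leNgt => /negP; apply.
by rewrite -ltrBlDl; apply: le_lt_trans supE; rewrite lerD2l lerN2 ltW.
Qed.

(** Apply the one-sided bound to [beta] and to [- beta], and unite the two exceptional sets. *)
Lemma small_off_measurable (beta : set T -> R) M e :
  set_additive beta -> (forall E, measurable E -> `|beta E| <= M) -> 0 < e ->
  exists2 E, measurable E &
    forall F, measurable F -> F `&` E = set0 -> `|beta F| <= e.
Proof.
move=> beta_add betaM e0.
have [E1 mE1 hE1] := small_off_measurable_pos beta_add betaM e0.
have [||E2 mE2 hE2] := @small_off_measurable_pos (fun E => - beta E) M e _ _ e0.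
- by move=> A B mA mB AB; rewrite beta_add// opprD.
- by move=> E mE; rewrite normrN betaM.
exists (E1 `|` E2); first exact: measurableU.
move=> F mF; rewrite setIUr setU_eq0 => -[F1 F2].
by rewrite ler_norml lerNl hE1// hE2.
Qed.

Lemma additive_ge0_mono (alpha : set T -> R) E F : set_additive alpha ->
  (forall G, measurable G -> 0 <= alpha G) -> measurable E -> measurable F ->
  E `<=` F -> alpha E <= alpha F.
Proof.
move=> alpha_add alpha0 mE mF EF.
rewrite (additive_setIDC alpha_add mF mE) (setIidr EF) lerDl alpha0//.
exact: measurableD.
Qed.

End bounded_set_functions.

(** * Partitions nearly attaining the Euclidean variation of [(alpha, beta)] *)

Section near_maximal_partition.
Context d (T : ringOfSetsType d) (R : realType).
Context (alpha beta : set T -> R) (alpha_add : set_additive alpha)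
  (alpha0 : forall E, measurable E -> 0 <= alpha E)
  (beta_add : set_additive beta)
  (M : R) (betaM : forall E, measurable E -> `|beta E| <= M).

Let N E := hypot (alpha E) (beta E).

Lemma sum_hypot_le E n (A : 'I_n -> set T) : finite_partition E A ->
  \sum_(i < n) N (A i) <= alpha E + 2 * M.
Proof.
move=> [mA tA UA].
apply: le_trans (ler_sum _ (fun i _ => hypot_le_add _ _)) _.
rewrite big_split /=; apply: lerD; last exact: sum_norm_le.
under eq_bigr do rewrite ger0_norm ?alpha0//.
rewrite -(additive_bigcup predT)// le_eqVlt; apply/orP; left; apply/eqP.
by congr alpha; rewrite -UA; apply: eq_bigcup.
Qed.

(** Cutting each cell by [F] yields another partition of [E]. Its sum stays below the supremum,
    which the original sum misses by less than [eta]. *)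
Lemma near_maximal_partition E eta : measurable E -> 0 < eta ->
  exists n (A : 'I_n -> set T), finite_partition E A /\
    forall F, measurable F -> F `<=` E ->
      \sum_(i < n) (N (F `&` A i) + N (A i `\` F) - N (A i)) <= eta.
Proof.
move=> mE eta0.
pose S := [set x | exists n (A : 'I_n -> set T),
  finite_partition E A /\ x = \sum_(i < n) N (A i)].
have supS : has_sup S.
  split.
    exists (\sum_(i < 1) N E), 1%N, (fun=> E); split => //; split => //.
      by move=> i j _ _ _; rewrite !ord1.
    by apply/seteqP; split => [x []//|x Ex]; exists ord0.
  exists (alpha E + 2 * M) => _ [n [A [pA ->]]]; exact: sum_hypot_le.
have [_ [n [A [pA ->]]] supA] := sup_adherent eta0 supS.
exists n, A; split=> // F mF FE.
have [mA tA UA] := pA.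
rewrite sumrB lerBlDr addrC -lerBlDr; apply: le_trans (ltW supA).
rewrite lerD2r; apply: ub_le_sup; first by case: supS.
pose B (k : 'I_(n + n)) := match fintype.split k with
  inl i => F `&` A i | inr i => A i `\` F end.
exists (n + n)%N, B; split; last first.
  rewrite big_split_ord big_split /=; congr (_ + _); apply: eq_bigr => i _.
  - by rewrite /B (unsplitK (inl i)).
  - by rewrite /B (unsplitK (inr i)).
split.
- by move=> k; rewrite /B; case: fintype.split => i;
    [exact: measurableI|exact: measurableD].
- move=> k l _ _ [x []]; rewrite /B -(splitK k) -(splitK l) !unsplitK.
  case: (fintype.split k) (fintype.split l) => i [] j.
  + by move=> [_ Ai] [_ Aj]; congr unsplit; congr inl; apply: tA => //; exists x.
  + by move=> [Fx _] [].
  + by move=> [_ nFx] [].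
  + by move=> [Ai _] [Aj _]; congr unsplit; congr inr; apply: tA => //; exists x.
- apply/seteqP; split => x.
    by move=> [k _]; rewrite /B; case: fintype.split => i [] => [/FE//|Ax _];
      rewrite -UA; exists i.
  move=> Ex; have := Ex; rewrite -UA => -[i _ Aix].
  have [Fx|Fx] := pselect (F x).
  + by exists (unsplit (inl i)) => //; rewrite /B unsplitK.
  + by exists (unsplit (inr i)) => //; rewrite /B unsplitK.
Qed.

End near_maximal_partition.

(** * Approximation of real set functions *)

Section real_approximation.
Context d (T : ringOfSetsType d) (R : realType).
Context (alpha beta : set T -> R) (alpha_add : set_additive alpha)
  (alpha0 : forall E, measurable E -> 0 <= alpha E)
  (beta_add : set_additive beta)
  (M : R) (betaM : forall E, measurable E -> `|beta E| <= M).
Context (beta_ac : forall e, 0 < e -> exists2 delta, 0 < delta &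
  forall E, measurable E -> alpha E < delta -> `|beta E| < e).

(* On the cells where [`|beta| < K * alpha] the function takes the value
   [beta / alpha].  The union [B] of the other cells satisfies
   [K * alpha B <= 2 * M], so absolute continuity makes [beta] small on the
   subsets of [B] when [K] is large. *)
Lemma approximation_on E e : measurable E -> 0 < e ->
  exists n (c : 'I_n -> R) (A : 'I_n -> set T), finite_partition E A /\
    forall F, measurable F -> F `<=` E ->
      `|beta F - \sum_(i < n) alpha (F `&` A i) * c i| <= e.
Proof.
move=> mE e0.
have M0 : 0 <= M := le_trans (normr_ge0 _) (betaM measurable0).
have [delta delta0 ac] := beta_ac (divr_gt0 e0 (ltr0n _ 2)).
(* Then [K * delta = 2 * M + delta], so [K * alpha B <= 2 * M] forces [alpha B < delta]. *)
pose K := 2 * M / delta + 1.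
have K0 : 0 < K by rewrite ltr_wpDl// divr_ge0 ?mulr_ge0// ltW.
pose L := alpha E + 2 * M + 1.
have L0 : 0 < L by rewrite ltr_wpDl// addr_ge0 ?alpha0 ?mulr_ge0.
have K10 : 0 < 1 + K by rewrite addr_gt0.
(* The good cells are to contribute at most [(1 + K) * (u + u) = e / 2]: one [u] is [s * L], the
   other is the total defect [2 * s * u] divided by [2 * s]. *)
pose u := e / 4 / (1 + K).
have u0 : 0 < u by rewrite !divr_gt0.
pose s := u / L.
have s0 : 0 < s by rewrite divr_gt0.
have s20 : 0 < 2 * s by rewrite mulr_gt0.
have [n [A [pA refA]]] :=
  near_maximal_partition alpha_add alpha0 beta_add betaM mE (mulr_gt0 s20 u0).
have [mA tA UA] := pA.
(* The strict inequality forces [alpha (A i) > 0], so the quotient on good cells is genuine. *)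
pose good i := `|beta (A i)| < K * alpha (A i).
exists n, (fun i => if good i then beta (A i) / alpha (A i) else 0), A.
split => // F mF FE.
have mFA i : measurable (F `&` A i) by exact: measurableI.
rewrite (finite_partition_sum beta_add pA mF FE).
rewrite -sumrB (bigID good) /=.
apply: le_trans (ler_normD _ _) _; rewrite (splitr e); apply: lerD; last first.
  pose B := \bigcup_(i in [set` predC good]) A i.
  have mB : measurable B by exact: measurable_bigcup_fin.
  under eq_bigr => i /negPf -> do rewrite mulr0 subr0.
  rewrite -additive_bigcup//; last exact: trivIset_setIl.
  rewrite -setI_bigcupr -/B; apply/ltW/ac; first exact: measurableI.
  apply: (@le_lt_trans _ _ (alpha B)).
    by apply: additive_ge0_mono => //; exact: measurableI.
  rewrite -(ltr_pM2l K0); apply: (@le_lt_trans _ _ (2 * M)).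
    rewrite additive_bigcup// mulr_sumr.
    apply: le_trans (sum_norm_le beta_add betaM mA tA).
    rewrite [leRHS](bigID good) /= -[leLHS]add0r; apply: lerD.
      exact: sumr_ge0.
    by apply: ler_sum => i; rewrite -leNgt.
  by rewrite /K [ltRHS]mulrDl divfK ?gt_eqF// mul1r ltrDl.
pose N E := hypot (alpha E) (beta E).
(* This is the bound of [hypot_defect_bound] for [A i] cut by [F]. It is nonnegative on bad cells
   too, so the sum may be extended to all cells, where the estimates on whole partitions apply. *)
pose t i := (1 + K) * (s * N (F `&` A i) +
  (N (F `&` A i) + N (A i `\` F) - N (A i)) / (2 * s)).
have alphaE i : alpha (A i) = alpha (F `&` A i) + alpha (A i `\` F).
  by rewrite (additive_setIDC alpha_add (mA i) mF) setIC.
have betaE i : beta (A i) = beta (F `&` A i) + beta (A i `\` F).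
  by rewrite (additive_setIDC beta_add (mA i) mF) setIC.
have t0 i : 0 <= t i.
  apply: mulr_ge0; first exact: ltW.
  apply: addr_ge0; first by rewrite mulr_ge0 ?hypot_ge0// ltW.
  apply: divr_ge0; last exact: ltW.
  by rewrite subr_ge0 /N (alphaE i) betaE hypotD.
apply: (@le_trans _ _ (\sum_(i < n) t i)).
  rewrite [leRHS](bigID good) /= -[leLHS]addr0; apply: lerD; last exact: sumr_ge0.
  apply: le_trans (ler_norm_sum _ _ _) _; apply: ler_sum => i gi.
  rewrite gi mulrC /t /N alphaE betaE; apply: hypot_defect_bound => //.
  - have : 0 < K * alpha (A i) by exact: le_lt_trans gi.
    by rewrite pmulr_rgt0// alphaE.
  - by rewrite -alphaE -betaE ltW.
rewrite -mulr_sumr big_split /= -mulr_sumr -mulr_suml.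
have -> : e / 2 = (1 + K) * (u + u).
  by rewrite -mulr2n -mulr_natr /u; field; rewrite gt_eqF.
rewrite ler_wpM2l ?(ltW K10)//; apply: lerD.
  have -> : u = s * L by rewrite /s divfK ?gt_eqF.
  rewrite ler_wpM2l ?(ltW s0)//.
  have pFA : finite_partition F (fun i => F `&` A i).
    split => //; first exact: trivIset_setIl.
    by rewrite -setI_bigcupr UA; exact: setIidl.
  apply: le_trans (sum_hypot_le alpha_add alpha0 beta_add betaM pFA) _.
  rewrite /L -addrA lerD ?lerDl//; first exact: additive_ge0_mono.
rewrite ler_pdivrMr// mulrC; exact: refA.
Qed.

Lemma simple_integral_additive (phi : T -> R) : ring_simple phi ->
  set_additive (fun E => simple_integral alpha E phi).
Proof.
move=> [n [c [A [mA ->]]]] E F mE mF EF0.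
rewrite !simple_integralE//; last exact: measurableU.
rewrite -big_split /=; apply: eq_bigr => i _; rewrite -scalerDl setIUl.
rewrite alpha_add//; [exact: measurableI|exact: measurableI|].
by rewrite setIACA EF0 set0I.
Qed.

(** Choose [E] off which [beta] is small, and [phi] from a partition of [E]. The error [gamma] is
    additive and at most [e / 4] both inside and off [E], where [phi] vanishes; [sum_norm_le] turns
    this uniform bound into one for disjoint families, at the cost of a factor [2]. *)
Lemma approximable_real : approximable alpha beta.
Proof.
move=> e e0.
have e40 : 0 < e / 4 by rewrite divr_gt0.
have [E mE offE] := small_off_measurable beta_add betaM e40.
have [n [c [A [pA onE]]]] := approximation_on mE e40.
have [mA tA UA] := pA.
pose phi (x : T) := \sum_(i < n) (\1_(A i) x : R) *: c i.
have sphi : ring_simple phi by exists n, c, A.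
exists phi; split => // m F mF tF.
pose gamma F := beta F - simple_integral alpha F phi.
have gamma_add : set_additive gamma.
  move=> G H mG mH GH0; rewrite /gamma beta_add// simple_integral_additive//.
  by rewrite opprD addrACA.
have -> : e = 2 * (e / 4 + e / 4) by lra.
apply: (sum_norm_le gamma_add) => // G mG.
rewrite (additive_setIDC gamma_add mG mE) addrC.
apply: le_trans (ler_normD _ _) _; apply: lerD.
- have GE0 : (G `\` E) `&` E = set0 by rewrite setIC setDIK.
  have mGE : measurable (G `\` E) by exact: measurableD.
  rewrite /gamma simple_integralE// big1 ?subr0; first exact: offE.
  move=> i _; rewrite [_ `&` _](_ : _ = set0) ?additive_set0 ?scale0r//.
  apply/seteqP; split => // x [[_ nEx] Aix]; apply: nEx.
  by rewrite -UA; exists i.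
- have mGE : measurable (G `&` E) by exact: measurableI.
  rewrite /gamma simple_integralE//; apply: onE => //; exact: subIsetr.
Qed.

End real_approximation.

(** * Real and imaginary parts, and the complex case *)

Section Rcomplex_norm.
Context {R : realType}.
Implicit Types z : Rcomplex R.

Lemma normr_Re_le z : `|complex.Re z| <= `|z|.
Proof. by case: z => a b; exact: normr_le_hypot. Qed.

Lemma normr_Im_le z : `|complex.Im z| <= `|z|.
Proof.
case: z => a b; apply: le_trans (normr_le_hypot b a) _.
by rewrite /hypot addrC.
Qed.

Lemma Rcomplex_ReIm z :
  z = complex.Re z *: ((1 +i* 0)%C : Rcomplex R) +
      complex.Im z *: ((0 +i* 1)%C : Rcomplex R).
Proof.
by case: z => a b; apply/eqP; rewrite eq_complex /= !mulr0 !mulr1 addr0 add0r !eqxx.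
Qed.

End Rcomplex_norm.

(** Here [f] will be the identity, the real part or the imaginary part. Boundedness and absolute
    continuity pass to [f \o beta] through [|f (beta E)| <= |beta E|], the latter being at most the
    variation on [E]. *)
Lemma approximable_comp d (T : ringOfSetsType d) (R : realType)
    (V : normedModType R) (alpha : set T -> R) (beta : set T -> V) (f : V -> R) :
  set_additive alpha -> (forall E, measurable E -> 0 <= alpha E) ->
  set_additive beta -> set_bounded beta -> set_abs_continuous beta alpha ->
  {morph f : x y / x + y} -> (forall x, `|f x| <= `|x|) ->
  approximable alpha (f \o beta).
Proof.
move=> alpha_add alpha0 beta_add /set_boundedP[M betaM] beta_ac fD fle.
apply: (approximable_real alpha_add alpha0 _ (M := M)) => [E F mE mF EF|E mE|e e0].
- by rewrite /= beta_add// fD.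
- exact: le_trans (fle _) (betaM _ mE).
- have [delta delta0 ac] := beta_ac _ e0; exists delta => // E mE Edelta.
  apply: le_lt_trans (fle _) _; rewrite -lte_fin.
  exact: le_lt_trans (le_set_variation _ mE) (ac _ mE Edelta).
Qed.

Theorem theorem3p2 (R : realType) (d : measure_display) (T : ringOfSetsType d)
  (alpha : set T -> R)
  (alpha_additive : set_additive alpha)
  (alpha_ge0 : forall E : set T, measurable E -> 0 <= alpha E) :
  (forall beta : set T -> R,
    set_additive beta -> set_bounded beta -> set_abs_continuous beta alpha ->
    exists phi : nat -> T -> R,
    let beta_ n E := simple_integral alpha E (phi n) in
    [/\ forall n, ring_simple (phi n),
        forall E, measurable E -> beta_ n E @[n --> \oo] --> beta E
      & set_bounded alpha ->
        ereal_sup [set set_variation (fun F => beta F - beta_ n F) E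
                  | E in measurable] @[n --> \oo] --> 0%E])
  /\
  (forall beta : set T -> Rcomplex R,
    set_additive beta -> set_bounded beta -> set_abs_continuous beta alpha ->
    exists phi : nat -> T -> Rcomplex R,
    let beta_ n E := simple_integral alpha E (phi n) in
    [/\ forall n, ring_simple (phi n),
        forall E, measurable E -> beta_ n E @[n --> \oo] --> beta E
      & set_bounded alpha ->
        ereal_sup [set set_variation (fun F => beta F - beta_ n F) E
                  | E in measurable] @[n --> \oo] --> 0%E]).
Proof.
have conclude (V : normedModType R) (beta : set T -> V) :
    approximable alpha beta -> exists phi : nat -> T -> V,
    let beta_ n E := simple_integral alpha E (phi n) in
    [/\ forall n, ring_simple (phi n),
        forall E, measurable E -> beta_ n E @[n --> \oo] --> beta E
      & set_bounded alpha ->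
        ereal_sup [set set_variation (fun F => beta F - beta_ n F) E
                  | E in measurable] @[n --> \oo] --> 0%E].
  by move=> /approximable_cvg[phi [? ? ?]]; exists phi.
split=> beta beta_add beta_bd beta_ac; apply: conclude.
  exact: (approximable_comp (f := id)).
(* Decompose [beta] along the vectors [1] and [i], so that each summand is a real set function times
   a fixed vector. *)
rewrite (_ : beta = fun E => complex.Re (beta E) *: ((1 +i* 0)%C : Rcomplex R) +
    complex.Im (beta E) *: ((0 +i* 1)%C : Rcomplex R)); last first.
  by apply/funext => E; exact: Rcomplex_ReIm.
apply: approximableD => //; apply: approximableZr => //.
- by apply: (@approximable_comp _ _ _ (Rcomplex R) _ beta (@complex.Re R)) => //;
     [move=> [? ?] [? ?]|exact: normr_Re_le].
- by apply: (@approximable_comp _ _ _ (Rcomplex R) _ beta (@complex.Im R)) => //;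
     [move=> [? ?] [? ?]|exact: normr_Im_le].
Qed.
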